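(* Let $\lambda, x \in \mathbb{C}$. For every integer $n\ge 0$, $$\sum_{m=0}^{n}B_m(x)\,\lambda^{n-m}S_1(n,m)=\sum_{l=0}^{n}\frac{l!}{l+1}\binom{n}{l}(-1)^l\lambda^l\beta_{n-l}(x\mid\lambda),$$ where $S_1(n,m)$ is the Stirling number of the first kind.
   Context: For $\lambda,x\in\mathbb{C}$ and an integer $n\ge 0$, put $(x\mid\lambda)_n = x(x-\lambda)(x-2\lambda)\cdots(x-(n-1)\lambda)$, with $(x\mid\lambda)_0=1$. As a formal power series in $t$, $(1+\lambda t)^{x/\lambda}=\sum_{n\ge0}(x\mid\lambda)_n\frac{t^n}{n!}$ (for $\lambda=0$ this is read as the limit $e^{xt}$). The Carlitz degenerate Bernoulli polynomials $\beta_n(x\mid\lambda)$ are defined by $$\frac{t}{(1+\lambda t)^{1/\lambda}-1}(1+\lambda t)^{x/\lambda}=\sum_{n=0}^{\infty}\beta_n(x\mid\lambda)\frac{t^n}{n!}.$$ The ordinary Bernoulli polynomials $B_n(x)$ are defined by $\frac{t}{e^t-1}e^{xt}=\sum_{n=0}^\infty B_n(x)\frac{t^n}{n!}$. The Stirling numbers of the first kind are the signed ones: $x(x-1)\cdots(x-n+1)=\sum_{m=0}^n S_1(n,m)x^m$. The convention $0^0=1$ is used. *)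

(* Defs.v *)
From HB Require Import structures.
From mathcomp Require Import all_boot all_order all_algebra.

Set Implicit Arguments.
Unset Strict Implicit.
Unset Printing Implicit Defensive.

Import Order.TTheory GRing.Theory Num.Theory.
Local Open Scope ring_scope.

(* A formal power series is its sequence of coefficients; equality of series
   is =1. Factorials are inverted below, so F is meant to have characteristic 0. *)
Definition fps (F : fieldType) : Type := nat -> F.

Definition fps_one (F : fieldType) : fps F := fun n => (n == 0%N)%:R.

Definition fps_X (F : fieldType) : fps F := fun n => (n == 1%N)%:R.

Definition fps_sub (F : fieldType) (f g : fps F) : fps F := fun n => f n - g n.

Definition fps_mul (F : fieldType) (f g : fps F) : fps F :=
  fun n => \sum_(i < n.+1) f i * g (n - i)%N.

(* If g is the inverse of f, this is the list [:: g_n; ...; g_0], computed from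
   f_0 g_0 = 1 and f_0 g_n = - \sum_(1 <= i <= n) f_i g_(n-i). *)
Fixpoint fps_inv_rev (F : fieldType) (f : fps F) (n : nat) : seq F :=
  if n is m.+1 then
    let s := fps_inv_rev f m in
    (- (f 0%N)^-1 * \sum_(i < n) f i.+1 * s`_i) :: s
  else [:: (f 0%N)^-1].

(* Meaningful when f 0 != 0, see fps_mulV. *)
Definition fps_inv (F : fieldType) (f : fps F) : fps F :=
  fun n => (fps_inv_rev f n)`_0%N.

(* t / f for a series f = f_1 t + f_2 t^2 + ... with f_1 != 0, obtained by
   cancelling t and inverting f_1 + f_2 t + ...; see fps_mul_X_over. *)
Definition fps_X_over (F : fieldType) (f : fps F) : fps F :=
  fps_inv (fun n => f n.+1).

(* (x | lam)_n *)
Definition gen_ffact (F : fieldType) (lam x : F) (n : nat) : F :=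
  \prod_(i < n) (x - i%:R * lam).

(* e^(x t) *)
Definition fps_exp (F : fieldType) (x : F) : fps F := fun n => x ^+ n / n`!%:R.

(* (1 + lam t)^(x / lam), which is e^(x t) for lam = 0 *)
Definition fps_dexp (F : fieldType) (lam x : F) : fps F :=
  fun n => gen_ffact lam x n / n`!%:R.

(* t / (e^t - 1) * e^(x t) *)
Definition bernoulli_gf (F : fieldType) (x : F) : fps F :=
  fps_mul (fps_X_over (fps_sub (fps_exp 1) (fps_one F))) (fps_exp x).

(* B_n(x) *)
Definition bernoulli_poly (F : fieldType) (n : nat) (x : F) : F :=
  n`!%:R * bernoulli_gf x n.

(* t / ((1 + lam t)^(1 / lam) - 1) * (1 + lam t)^(x / lam) *)
Definition carlitz_gf (F : fieldType) (lam x : F) : fps F :=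
  fps_mul (fps_X_over (fps_sub (fps_dexp lam 1) (fps_one F))) (fps_dexp lam x).

(* beta_n(x | lam) *)
Definition carlitz_bernoulli (F : fieldType) (lam : F) (n : nat) (x : F) : F :=
  n`!%:R * carlitz_gf lam x n.

(* Signed Stirling numbers of the first kind. *)
Definition stirling1 (n m : nat) : int :=
  (\prod_(i < n) ('X - (i%:R : int)%:P))`_m.

Lemma fps_inv_rev_nth (F : fieldType) (f : fps F) n i :
  (i <= n)%N -> (fps_inv_rev f n)`_i = fps_inv f (n - i)%N.
Proof.
elim: n i => [|n IH] [|i] // le_in.
by rewrite subSS -IH.
Qed.

Lemma fps_mulV (F : fieldType) (f : fps F) :
  f 0%N != 0 -> fps_mul f (fps_inv f) =1 fps_one F.
Proof.
move=> f0 [|n]; rewrite /fps_mul /fps_one big_ord_recl subn0.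
  by rewrite big_ord0 addr0 divff.
rewrite {1}/fps_inv [fps_inv_rev _ _]/= [X in _ * X]/= mulrA mulrN divff // mulN1r.
apply/eqP; rewrite addrC subr_eq0; apply/eqP/eq_bigr => i _.
by rewrite fps_inv_rev_nth ?subSS // -ltnS.
Qed.

Lemma fps_mul_X_over (F : fieldType) (f : fps F) :
  f 0%N = 0 -> f 1%N != 0 -> fps_mul f (fps_X_over f) =1 fps_X F.
Proof.
move=> f0 f1 [|n].
  by rewrite /fps_mul big_ord_recl big_ord0 f0 mul0r addr0.
have /(_ n) := @fps_mulV F (fun n => f n.+1) f1.
rewrite /fps_mul /fps_one /fps_X eqSS => <-.
rewrite big_ord_recl f0 mul0r add0r; apply: eq_bigr => i _.
by rewrite /= subSS.
Qed.

Lemma fps_mulA (F : fieldType) (f g h : fps F) :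
  fps_mul f (fps_mul g h) =1 fps_mul (fps_mul f g) h.
Proof.
move=> n.
have trunc (a b : fps F) k : (k <= n)%N ->
    fps_mul a b k = ((\poly_(i < n.+1) a i) * (\poly_(i < n.+1) b i))`_k.
  move=> le_kn; rewrite coefM; apply: eq_bigr => i _.
  rewrite !coef_poly !ltnS (leq_trans (leq_subr _ _) le_kn).
  by rewrite (leq_trans _ le_kn) // -ltnS.
transitivity ((\poly_(i < n.+1) f i * (\poly_(i < n.+1) g i * \poly_(i < n.+1) h i))`_n).
  rewrite coefM; apply: eq_bigr => i _.
  by rewrite trunc ?leq_subr // coef_poly ltn_ord.
rewrite mulrA coefM; apply: eq_bigr => i _.
by rewrite trunc -1?ltnS // coef_poly ltnS leq_subr.
Qed.

Lemma fps_X_over_gf (F : fieldType) (f g : fps F) :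
  f 0%N = 1 -> f 1%N = 1 ->
  fps_mul (fps_sub f (fps_one F)) (fps_mul (fps_X_over (fps_sub f (fps_one F))) g)
    =1 fps_mul (fps_X F) g.
Proof.
move=> f0 f1 n; rewrite fps_mulA; apply: eq_bigr => i _.
by rewrite fps_mul_X_over // /fps_sub /fps_one ?f0 ?f1 ?subrr ?subr0 ?oner_eq0.
Qed.

(* (e^t - 1) * bernoulli_gf x = t e^(x t) *)
Lemma bernoulli_gfE (F : fieldType) (x : F) :
  fps_mul (fps_sub (fps_exp 1) (fps_one F)) (bernoulli_gf x)
    =1 fps_mul (fps_X F) (fps_exp x).
Proof. by apply: fps_X_over_gf; rewrite /fps_exp expr1n divr1. Qed.

(* ((1 + lam t)^(1 / lam) - 1) * carlitz_gf lam x = t (1 + lam t)^(x / lam) *)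
Lemma carlitz_gfE (F : fieldType) (lam x : F) :
  fps_mul (fps_sub (fps_dexp lam 1) (fps_one F)) (carlitz_gf lam x)
    =1 fps_mul (fps_X F) (fps_dexp lam x).
Proof.
apply: fps_X_over_gf; rewrite /fps_dexp /gen_ffact.
  by rewrite big_ord0 divr1.
by rewrite big_ord1 mul0r subr0 divr1.
Qed.

Lemma fps_dexp0 (F : fieldType) (x : F) : fps_dexp 0 x =1 fps_exp x.
Proof.
move=> n; rewrite /fps_dexp /fps_exp /gen_ffact.
under eq_bigr do rewrite mulr0 subr0.
by rewrite prodr_const card_ord.
Qed.

(* Main.v *)
(** Substituting [t := log (1 + lam t) / lam] turns [t / (e^t - 1) * e^(x t)]
    into [log (1 + lam t) / (lam t)] times the generating function of the
    Carlitz polynomials; the two sides of the theorem are the coefficients of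
    these two series. The substitution is the linear operator [log_subst]
    below, whose matrix consists of rescaled Stirling numbers. It intertwines
    [d/dt] with [(1 + lam t) d/dt], both of which are derivations, and is
    therefore multiplicative. *)
Require Import Defs.
From mathcomp Require Import all_boot all_order all_algebra.
From mathcomp Require Import reals complex.
From mathcomp Require Import ring.

Import GRing.Theory.
Local Open Scope ring_scope.
Local Open Scope complex_scope.

(** * Cancellation and derivations for formal power series *)

Section PowerSeries.
Context {F : fieldType}.
Implicit Types (f g h : fps F) (c : F).

Lemma eq_fps_mul f f' g g' :
  f =1 f' -> g =1 g' -> fps_mul f g =1 fps_mul f' g'.
Proof. by move=> ff' gg' n; apply: eq_bigr => i _; rewrite ff' gg'. Qed.

Lemma fps_mulC f g : fps_mul f g =1 fps_mul g f.
Proof.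
move=> n; rewrite /fps_mul (reindex_inj rev_ord_inj) /=.
by apply: eq_bigr => i _; rewrite subSS subKn -1?ltnS // mulrC.
Qed.

Lemma fps_mulXS f n : fps_mul (fps_X F) f n.+1 = f n.
Proof.
rewrite /fps_mul /fps_X !big_ord_recl mul0r add0r /= mul1r subSS subn0.
by rewrite big1 ?addr0 // => i _; rewrite mul0r.
Qed.

Lemma fps_mulX0 f : fps_mul (fps_X F) f 0 = 0.
Proof. by rewrite /fps_mul big_ord1 mul0r. Qed.

(** Multiplying by [t / f] turns [f g] into [t g], whose coefficients are those of [g] shifted by
    one. *)
Lemma fps_mulI f g h :
  f 0 = 0 -> f 1%N != 0 -> fps_mul f g =1 fps_mul f h -> g =1 h.
Proof.
move=> f0 f1 eq_fgh n; rewrite -(fps_mulXS g) -(fps_mulXS h).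
have Xf k : fps_mul (fps_X F) k =1 fps_mul (fps_X_over f) (fps_mul f k).
  move=> m; rewrite fps_mulA; apply: eq_fps_mul => // i.
  by rewrite fps_mulC fps_mul_X_over.
by rewrite !Xf; apply: eq_fps_mul.
Qed.

Definition fps_deriv f : fps F := fun n => n.+1%:R * f n.+1.

(* [(1 + c t) f'] *)
Definition fps_derivX c f : fps F := fun n => fps_deriv f n + c * n%:R * f n.

(** Leibniz rule for [t d/dt]: the weight [n] splits as [i + (n - i)] in each term of the
    product. *)
Lemma fps_theta_mul f g n :
  n%:R * fps_mul f g n =
    \sum_(i < n.+1) i%:R * f i * g (n - i)%N +
    \sum_(i < n.+1) f i * ((n - i)%:R * g (n - i)%N).
Proof.
rewrite mulr_sumr -big_split; apply: eq_bigr => i _ /=.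
by rewrite -{1}(@subnKC i n) -1?ltnS // natrD; ring.
Qed.

Lemma fps_deriv_mul f g n :
  fps_deriv (fps_mul f g) n =
    fps_mul (fps_deriv f) g n + fps_mul f (fps_deriv g) n.
Proof.
rewrite /fps_deriv fps_theta_mul; congr (_ + _).
  by rewrite big_ord_recl !mul0r add0r; apply: eq_bigr => i _; rewrite subSS.
rewrite big_ord_recr /= subnn mul0r mulr0 addr0.
by apply: eq_bigr => i _; rewrite subSn // -ltnS.
Qed.

(** [(1 + c t) d/dt] is [d/dt] plus [c] times [t d/dt], and both of these obey the Leibniz rule. *)
Lemma fps_derivX_mul c f g n :
  fps_derivX c (fps_mul f g) n =
    fps_mul (fps_derivX c f) g n + fps_mul f (fps_derivX c g) n.
Proof.
rewrite {1}/fps_derivX fps_deriv_mul -mulrA fps_theta_mul mulrDr.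
rewrite /fps_mul !mulr_sumr -!big_split; apply: eq_bigr => i _.
by rewrite /fps_derivX /=; ring.
Qed.

End PowerSeries.

(** * The polynomial [(X | lam)_n] and Stirling numbers *)

Definition ffact_poly (F : fieldType) (lam : F) (n : nat) : {poly F} :=
  \prod_(i < n) ('X - (i%:R * lam)%:P).

Section FactorialPoly.
Context {F : fieldType} (lam : F).

Lemma size_ffact_poly n : size (ffact_poly F lam n) = n.+1.
Proof. by rewrite size_prod_XsubC [index_enum _]unlock -enumT size_enum_ord. Qed.

Lemma ffact_polyS n :
  ffact_poly F lam n.+1 = ffact_poly F lam n * ('X - (n%:R * lam)%:P).
Proof. exact: big_ord_recr. Qed.

Lemma coef0_ffact_poly n : (ffact_poly F lam n)`_0 = (n == 0)%:R.
Proof.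
elim: n => [|n IHn]; first by rewrite /ffact_poly big_ord0 coefC.
rewrite ffact_polyS mulrBr coefB coefMX coefMC IHn /= sub0r.
by case: n {IHn} => [|n]; rewrite !mul0r ?mulr0 oppr0.
Qed.

Lemma coefS_ffact_poly n m :
  (ffact_poly F lam n.+1)`_m.+1 =
    (ffact_poly F lam n)`_m - n%:R * lam * (ffact_poly F lam n)`_m.+1.
Proof. by rewrite ffact_polyS mulrBr coefB coefMX coefMC [_ * (_ * _)]mulrC. Qed.

Lemma horner_ffact_poly n x : (ffact_poly F lam n).[x] = gen_ffact lam x n.
Proof. by rewrite horner_prod; apply: eq_bigr => i _; rewrite hornerXsubC. Qed.

End FactorialPoly.

Lemma stirling1_small n m : (n < m)%N -> stirling1 n m = 0.
Proof.
by move=> nm; rewrite /stirling1 nth_default // size_prod_XsubC [index_enum _]unlock -enumT size_enum_ord.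
Qed.

Lemma stirling1S0 n : stirling1 n.+1 0 = - (n%:R * stirling1 n 0).
Proof.
rewrite /stirling1 big_ord_recr /= mulrBr coefB coefMX coefMC sub0r.
by rewrite [_ * n%:R]mulrC.
Qed.

Lemma stirling1SS n m :
  stirling1 n.+1 m.+1 = stirling1 n m - n%:R * stirling1 n m.+1.
Proof.
rewrite /stirling1 big_ord_recr /= mulrBr coefB coefMX coefMC.
by rewrite [_ * n%:R]mulrC.
Qed.

(** Comparing the recurrences in [n], rather than substituting [X / lam] in the ordinary falling
    factorial, also covers [lam = 0]. *)
Lemma coef_ffact_poly (F : fieldType) (lam : F) n m :
  (ffact_poly F lam n)`_m = lam ^+ (n - m) * (stirling1 n m)%:~R.
Proof.
elim: n m => [|n IHn] [|m].
- by rewrite /ffact_poly /stirling1 !big_ord0 !coefC mul1r.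
- by rewrite /ffact_poly /stirling1 !big_ord0 !coefC mulr0.
- rewrite ffact_polyS mulrBr coefB coefMX coefMC sub0r IHn stirling1S0 !subn0.
  by rewrite rmorphN rmorphM /= rmorph_nat exprS; ring.
- rewrite coefS_ffact_poly !IHn stirling1SS subSS.
  rewrite rmorphB rmorphM /= rmorph_nat.
  (* For [n <= m] the truncated exponent [n - m.+1] is harmless, as [S_1(n, m + 1) = 0]. *)
  case: (ltnP m n) => [mn|nm]; last by rewrite (@stirling1_small n m.+1) //; ring.
  by rewrite -(subnSK mn) exprS; ring.
Qed.

(* [f (log (1 + lam t) / lam)]: by definition of [S_1] the coefficient of [t^n]
   in [(log (1 + lam t) / lam)^m] is [m! / n! * lam^(n - m) * S_1(n, m)]. *)
Definition log_subst (F : fieldType) (lam : F) (f : fps F) : fps F :=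
  fun n => (\sum_(m < n.+1) f m * m`!%:R * (ffact_poly F lam n)`_m) / n`!%:R.

(* [log (1 + lam t) / (lam t)] *)
Definition log_over_X (F : fieldType) (lam : F) : fps F :=
  fun n => (- lam) ^+ n / n.+1%:R.

(** * The logarithmic substitution and its action on generating functions *)

Section LogSubst.
Context {F : numFieldType} (lam : F).
Local Notation T := (log_subst F lam).
Implicit Types (f g : fps F).

Lemma fact_neq0 n : n`!%:R != 0 :> F.
Proof. by rewrite Num.Theory.pnatr_eq0 -lt0n fact_gt0. Qed.

Lemma natS_neq0 n : n.+1%:R != 0 :> F.
Proof. by rewrite Num.Theory.pnatr_eq0. Qed.

Lemma eq_log_subst f g : f =1 g -> T f =1 T g.
Proof.
by move=> fg n; congr (_ / _); apply: eq_bigr => m _; rewrite fg.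
Qed.

Lemma log_substD f g n : T (fun k => f k + g k) n = T f n + T g n.
Proof.
rewrite /log_subst -mulrDl -big_split; congr (_ / _).
by apply: eq_bigr => m _; rewrite !mulrDl.
Qed.

Lemma log_substB f g n : T (fps_sub f g) n = T f n - T g n.
Proof.
rewrite /log_subst -mulrBl -sumrB; congr (_ / _).
by apply: eq_bigr => m _; rewrite !mulrBl.
Qed.

Lemma log_subst0 f : T f 0 = f 0.
Proof.
by rewrite /log_subst big_ord1 coef0_ffact_poly !mulr1 divr1.
Qed.

(** This is the chain rule for [L = log (1 + lam t) / lam], where [(1 + lam t) L' = 1]. On
    coefficients it amounts to the recurrence [coefS_ffact_poly]. *)
Lemma log_subst_deriv f : T (fps_deriv f) =1 fps_derivX lam (T f).
Proof.
have TE g k : T g k * k`!%:R =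
    \sum_(m < k.+1) g m * m`!%:R * (ffact_poly F lam k)`_m.
  by rewrite divfK ?fact_neq0.
move=> n; apply: (mulIf (fact_neq0 n)).
rewrite TE /fps_derivX /fps_deriv mulrDl.
rewrite mulrAC -natrM -factS [_ * T f n.+1]mulrC TE -[_ * T f n * _]mulrA TE.
rewrite [X in _ = X + _]big_ord_recl coef0_ffact_poly mulr0 add0r.
under [X in _ = X + _]eq_bigr do rewrite lift0 coefS_ffact_poly mulrBr.
rewrite sumrB -addrA -[LHS]addr0; congr (_ + _).
  by apply: eq_bigr => m _; rewrite factS natrM; ring.
apply/esym/eqP; rewrite addrC subr_eq0; apply/eqP.
(* The two remaining sums differ by an index shift. Of the unmatched terms, one has index [n + 1],
   above the degree [n]; the other has index 0, where either [n] or the constant coefficient is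
   0. *)
rewrite big_ord_recl [RHS]big_ord_recr /= coef0_ffact_poly.
rewrite [in RHS]nth_default ?size_ffact_poly // !mulr0 addr0 mulrDr.
have -> : lam * n%:R * (f 0 * 0`!%:R * (n == 0)%:R) = 0.
  by case: n => [|n]; rewrite ?mulr0 // mul0r.
rewrite add0r mulr_sumr; apply: eq_bigr => m _.
by rewrite /bump; ring.
Qed.

(** Induction on the coefficient index, for all [f] and [g] at once: coefficient [n] of
    [(1 + lam t) h'] together with [h n] determines [h n.+1], since [n + 1] is invertible. *)
Lemma log_subst_mul f g : T (fps_mul f g) =1 fps_mul (T f) (T g).
Proof.
move=> n; elim: n f g => [|n IHn] f g.
  by rewrite log_subst0 /fps_mul !big_ord1 !log_subst0.
apply: (mulfI (natS_neq0 n)).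
(* Adding this term, equal on both sides by induction, completes each side to a coefficient of
   [fps_derivX]. *)
apply: (addIr (lam * n%:R * T (fps_mul f g) n)).
rewrite [LHS](_ : _ = fps_derivX lam (T (fps_mul f g)) n) // {1}IHn.
rewrite [RHS](_ : _ = fps_derivX lam (fps_mul (T f) (T g)) n) //.
rewrite -log_subst_deriv (eq_log_subst _ _ (fps_deriv_mul f g)).
rewrite (log_substD (fps_mul _ _)) !IHn fps_derivX_mul.
by congr (_ + _); apply: eq_fps_mul => // k; rewrite log_subst_deriv.
Qed.

Lemma log_subst1 : T (fps_one F) =1 fps_one F.
Proof.
move=> n; rewrite /log_subst /fps_one big_ord_recl big1 => [|m _]; last first.
  by rewrite !mul0r.
rewrite coef0_ffact_poly !mul1r addr0.
by case: n => [|n]; rewrite ?divr1 // mul0r.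
Qed.

(** The image of [t] solves [(1 + lam t) y' = 1], [y(0) = 0], which fixes its coefficients
    recursively. *)
Lemma log_substX : T (fps_X F) =1 fps_mul (fps_X F) (log_over_X F lam).
Proof.
have DX : fps_deriv (fps_X F) =1 fps_one F.
  by case=> [|k]; rewrite /fps_deriv ?mulr1 // mulr0.
have TX n : n.+1%:R * T (fps_X F) n.+1 = fps_one F n - lam * n%:R * T (fps_X F) n.
  apply/eqP; rewrite -subr_eq opprK -log_subst1 -(eq_log_subst _ _ DX).
  by rewrite log_subst_deriv.
case=> [|n]; first by rewrite log_subst0 fps_mulX0.
rewrite fps_mulXS; elim: n => [|n IHn].
  apply: (mulfI (natS_neq0 0)); rewrite TX /log_over_X.
  by rewrite mulr0 mul0r subr0 divr1 mulr1.
apply: (mulfI (natS_neq0 n.+1)); rewrite TX IHn /log_over_X sub0r.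
rewrite [RHS]mulrC -mulrA [n.+1%:R * _]mulrC !divfK ?natS_neq0 //.
by rewrite exprS mulNr.
Qed.

(** The factor [m!] cancels the denominator in [e^(x t)], leaving [(X | lam)_n] evaluated at [x]. *)
Lemma log_subst_exp x : T (fps_exp x) =1 fps_dexp lam x.
Proof.
move=> n; congr (_ / _).
rewrite -horner_ffact_poly (@horner_coef_wide _ n.+1) ?size_ffact_poly //.
by apply: eq_bigr => m _; rewrite /fps_exp divfK ?fact_neq0 // mulrC.
Qed.

(** Both sides agree after multiplication by [(1 + lam t)^(1 / lam) - 1]: the left by applying the
    substitution to [bernoulli_gfE], the right by [carlitz_gfE]. This factor has order exactly 1, so
    it cancels. *)
Lemma log_subst_bernoulli_gf x :
  T (bernoulli_gf x) =1 fps_mul (log_over_X F lam) (carlitz_gf lam x).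
Proof.
have d0 : fps_sub (fps_dexp lam 1) (fps_one F) 0 = 0.
  by rewrite /fps_sub /fps_dexp /gen_ffact big_ord0 divr1 subrr.
have d1 : fps_sub (fps_dexp lam 1) (fps_one F) 1%N != 0.
  rewrite /fps_sub /fps_dexp /gen_ffact big_ord1 mul0r divr1 !subr0.
  exact: oner_neq0.
apply: (fps_mulI _ _ _ d0 d1) => n.
transitivity (T (fps_mul (fps_sub (fps_exp 1) (fps_one F)) (bernoulli_gf x)) n).
  rewrite log_subst_mul; apply: eq_fps_mul => // k.
  by rewrite log_substB log_subst_exp log_subst1.
rewrite (eq_log_subst _ _ (bernoulli_gfE x)) log_subst_mul.
rewrite (eq_fps_mul _ _ _ _ log_substX (log_subst_exp x)).
rewrite (eq_fps_mul _ _ _ _ (fps_mulC _ _) (frefl _)) -fps_mulA.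
rewrite (eq_fps_mul _ _ _ _ (frefl _) (fsym (carlitz_gfE lam x))).
rewrite [LHS]fps_mulA [RHS]fps_mulA.
exact: eq_fps_mul (fps_mulC _ _) (frefl _) n.
Qed.

End LogSubst.

Theorem theorem2p4 (R : realType) (lam x : R[i]) (n : nat) :
  \sum_(m < n.+1) bernoulli_poly m x * lam ^+ (n - m) * (stirling1 n m)%:~R
  = \sum_(l < n.+1) l`!%:R / l.+1%:R * 'C(n, l)%:R * (-1) ^+ l * lam ^+ l
      * carlitz_bernoulli lam (n - l) x.
Proof.
transitivity (log_subst _ lam (bernoulli_gf x) n * n`!%:R).
  rewrite /log_subst divfK ?fact_neq0 //; apply: eq_bigr => m _.
  by rewrite coef_ffact_poly /bernoulli_poly [_`!%:R * _]mulrC mulrA.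
rewrite log_subst_bernoulli_gf mulr_suml; apply: eq_bigr => l _.
(* Writing [n!] as ['C(n, l) * (l! * (n - l)!)] supplies the binomial, the [l!] and the
   normalization of [carlitz_bernoulli]. *)
rewrite /log_over_X /carlitz_bernoulli -(@bin_fact n l) -1?ltnS // !natrM.
by rewrite [(- lam) ^+ l]exprNn; ring.
Qed.
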